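(* For each $k\in\{1,2,\dots,m\}$, the space $\pi'_c(P(\widetilde{X}_k))$ is homeomorphic to $\pi'_{c/r_k}(P(\widetilde{X}_k))$. Moreover, $E(\lambda^k)/G(c_k)$ is homeomorphic to $E(\lambda^k)/G(c_k/r_k)$.
   Context: Fix integers $1\le d<n$, $W=(w_1,\dots,w_n)\in(\mathbb{Z}_{\ge 0})^n$ and an integer $a\ge 1$. Let $M_d(n,d)$ be the set of complex $n\times d$ matrices of rank $d$. A Schubert symbol for $d<n$ is a sequence of integers $\lambda=(\lambda_1,\dots,\lambda_d)$ with $1\le\lambda_1<\cdots<\lambda_d\le n$; $\lambda\preceq\mu$ if $\lambda_j\le\mu_j$ for all $j$. Put $m:=\binom{n}{d}-1$ and fix a total order $\lambda^0<\cdots<\lambda^m$ on Schubert symbols preserving $\preceq$. Put $c_i:=a+\sum_{j=1}^d w_{\lambda^i_j}$ and $r_k:=\gcd\{c_0,\dots,c_k\}$ for $1\le k\le m$. For $A\in M_d(n,d)$ let $A_\lambda$ be the $d\times d$ matrix formed by rows $\lambda_1,\dots,\lambda_d$ of $A$, and let $P:M_d(n,d)\to\mathbb{C}^{m+1}\setminus\{0\}$, $P(A)=(\det A_{\lambda^0},\dots,\det A_{\lambda^m})$. Put $\widetilde{X}_k:=\{A\in M_d(n,d)\mid \det(A_{\lambda^j})=0\text{ for } j>k\}$; thus $P(\widetilde{X}_k)\subseteq\mathbb{C}^{k+1}\setminus\{0\}$ (first $k+1$ coordinates). For positive integers $b=(b_0,\dots,b_k)$, $\pi'_b:\mathbb{C}^{k+1}\setminus\{0\}\to\mathbb{W}P(b_0,\dots,b_k)$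 is the quotient map by the $\mathbb{C}^*$-action $t(z_0,\dots,z_k)=(t^{b_0}z_0,\dots,t^{b_k}z_k)$; on $P(\widetilde X_k)$, $\pi'_c$ is the case $b=(c_0,\dots,c_k)$ and $\pi'_{c/r_k}$ is the case $b=(c_0/r_k,\dots,c_k/r_k)$. Let $\pi:M_d(n,d)\to\mathrm{Gr}(d,n)$ send a matrix to its column space, and let $E(\lambda)=\{X\in\mathrm{Gr}(d,n)\mid\dim(X\cap\mathbb{C}^{\lambda_j})=j,\ \dim(X\cap\mathbb{C}^{\lambda_j-1})=j-1,\ 1\le j\le d\}$, where $\mathbb{C}^k=\{(z_1,\dots,z_k,0,\dots,0)\}\subset\mathbb{C}^n$. Let $G(c)$ denote the group of $c$-th roots of unity. $G(c_i)$ acts on $E(\lambda^i)$ by $t\cdot\pi(A)=\pi(\mathrm{diag}(t^{w_1},\dots,t^{w_n})A)$. If $r$ divides $c_0,\dots,c_i$, then $G(r)\subseteq G(c_i)$ acts trivially on $E(\lambda^i)$, and $G(c_i/r)\cong G(c_i)/G(r)$ (via $t\mapsto t^r$) acts on $E(\lambda^i)$ through this identification. *)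

(* Defs.v *)
From HB Require Import structures.
From mathcomp Require Import all_boot all_order all_algebra.
From mathcomp Require Import perm complex.
From mathcomp Require Import all_classical reals topology.

Set Implicit Arguments.
Unset Strict Implicit.
Unset Printing Implicit Defensive.

Import Order.TTheory GRing.Theory Num.Theory.
Local Open Scope classical_set_scope.
Local Open Scope ring_scope.
Local Open Scope complex_scope.
Local Open Scope quotient_scope.

(* The norm topology, which the library attaches only to R[i]^o. *)
HB.instance Definition _ (R : realType) := Topological.copy R[i] R[i]^o.

Definition homeomorphic (T U : topologicalType) : Prop :=
  exists (f : T -> U) (g : U -> T),
    [/\ continuous f, continuous g, cancel f g & cancel g f].

Section ColumnSpaces.
Variables (K : fieldType) (n : nat).

Definition colspan p (A : 'M[K]_(n, p)) : {vspace 'cV[K]_n} :=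
  limg (linfun (mulmx A : 'cV[K]_p -> 'cV[K]_n)).

Lemma colspanP p (A : 'M[K]_(n, p)) v :
  reflect (exists u, v = A *m u) (v \in colspan A).
Proof.
apply: (iffP memv_imgP) => [[u _ ->]|[u ->]]; exists u; rewrite ?memvf ?lfunE//.
Qed.

Lemma mulmx_inj_rank p (A : 'M[K]_(n, p)) :
  (forall u : 'cV_p, A *m u = 0 -> u = 0) <-> \rank A = p.
Proof.
rewrite -mxrank_tr; split => [inj|rk u Au0].
  apply/eqP; rewrite -/(row_free A^T) -kermx_eq0; apply/eqP/row_matrixP => i.
  rewrite row0; apply: trmx_inj; rewrite trmx0; apply: inj.
  by apply: trmx_inj; rewrite trmx_mul trmxK -row_mul mulmx_ker row0 trmx0.
have fr : row_free A^T by rewrite /row_free rk.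
apply: trmx_inj; rewrite trmx0; apply: (row_free_inj fr).
by rewrite mul0mx -trmx_mul Au0 trmx0.
Qed.

Lemma dim_colspan p (A : 'M[K]_(n, p)) : \rank A = p -> \dim (colspan A) = p.
Proof.
move=> /mulmx_inj_rank inj; rewrite limg_dim_eq; first by rewrite dimvf /dim /= muln1.
apply/eqP; rewrite -subv0; apply/subvP => u /memv_capP[_].
by rewrite memv_ker lfunE /= memv0 => /eqP /inj ->.
Qed.

Lemma colspan_surj d (V : {vspace 'cV[K]_n}) :
  \dim V = d -> exists2 A : 'M[K]_(n, d), \rank A = d & colspan A = V.
Proof.
move=> <-; pose A := \matrix_(i < n, j < \dim V) tnth (vbasis V) j i 0.
have AE u : A *m u = \sum_j u j 0 *: tnth (vbasis V) j.
  apply/colP => i; rewrite !mxE summxE; apply: eq_bigr => j _.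
  by rewrite !mxE mulrC.
exists A.
  apply/mulmx_inj_rank => u; rewrite AE => u0; apply/colP => j; rewrite mxE.
  apply: (@freeP _ _ _ (vbasis V) (basis_free (vbasisP V)) (fun j => u j 0)).
  by rewrite -{}[RHS]u0; apply: eq_bigr => i _; rewrite (tnth_nth 0).
apply/vspaceP => v; apply/colspanP/idP => [[u ->]|vV].
  rewrite AE; apply: rpred_sum => j _; apply: rpredZ.
  exact/vbasis_mem/mem_tnth.
exists (\col_j coord (vbasis V) j v); rewrite AE {1}(coord_vbasis vV).
by apply: eq_bigr => j _; rewrite mxE (tnth_nth 0).
Qed.

Lemma colspan_mul p (A : 'M[K]_(n, p)) (D : 'M[K]_n) :
  (linfun (mulmx D : 'cV[K]_n -> 'cV[K]_n) @: colspan A)%VS = colspan (D *m A).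
Proof.
apply/vspaceP => v; apply/memv_imgP/colspanP.
  by move=> [w /colspanP[u ->] ->]; exists u; rewrite lfunE /= mulmxA.
move=> [u ->]; exists (A *m u); first by apply/colspanP; exists u.
by rewrite lfunE /= mulmxA.
Qed.

Lemma colspan_mulr p (A : 'M[K]_(n, p)) (U : 'M[K]_p) :
  U \in unitmx -> colspan (A *m U) = colspan A.
Proof.
move=> uU; apply/vspaceP => v; apply/colspanP/colspanP => -[u ->].
  by exists (U *m u); rewrite mulmxA.
by exists (invmx U *m u); rewrite -mulmxA mulKVmx.
Qed.

(* { (z_1, .., z_k, 0, .., 0) } *)
Definition flag (k : nat) : {vspace 'cV[K]_n} := colspan (pid_mx k : 'M[K]_n).

Lemma flagP k (v : 'cV[K]_n) :
  reflect (forall i : 'I_n, (k <= i)%N -> v i 0 = 0) (v \in flag k).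
Proof.
have pE u (i : 'I_n) : ((pid_mx k : 'M[K]_n) *m u) i 0 = (i < k)%:R * u i 0.
  rewrite mxE (bigD1 i)//= mxE eqxx /= big1 ?addr0// => j ji.
  by rewrite mxE eq_sym (inj_eq val_inj) (negPf ji) mul0r.
apply: (iffP (colspanP _ _)) => [[u ->] i ki|v0].
  by rewrite pE ltnNge ki mul0r.
exists v; apply/colP => i; rewrite pE; case: ltnP => [|/v0 ->];
  by rewrite ?mul1r ?mulr0.
Qed.

Lemma linfun_ker0 (D : 'M[K]_n) :
  D \in unitmx -> lker (linfun (mulmx D : 'cV[K]_n -> 'cV[K]_n)) == 0%VS.
Proof.
move=> uD; apply/lker0P => u v; rewrite !lfunE /= => /(congr1 (mulmx (invmx D))).
by rewrite !mulKmx.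
Qed.

Lemma flag_diag (e : 'rV[K]_n) k : diag_mx e \in unitmx ->
  (linfun (mulmx (diag_mx e) : 'cV[K]_n -> 'cV[K]_n) @: flag k)%VS = flag k.
Proof.
move=> uD; apply/eqP; rewrite eqEdim limg_dim_eq ?leqnn ?andbT; last first.
  by rewrite (eqP (linfun_ker0 uD)) capv0.
apply/subvP => v /memv_imgP[u /flagP u0 ->]; apply/flagP => i /u0 ui0.
by rewrite lfunE /= mul_diag_mx mxE ui0 mulr0.
Qed.

End ColumnSpaces.
Section SchubertSymbols.
Variables n d : nat.

(* Indices and entries are shifted to start from 0. *)
Definition schubert := {l : d.-tuple 'I_n | sorted ltn (map val l)}.

Definition symb (l : schubert) (j : 'I_d) : 'I_n := tnth (val l) j.

Definition preceq (l1 l2 : schubert) : bool :=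
  [forall j, (symb l1 j <= symb l2 j)%N].

(* There are 'C(n, d) symbols; a total order on them is given by its
   increasing enumeration l^0 < ... < l^m. *)
Record schubert_order := SchubertOrder {
  sorder :> 'I_('C(n, d).-1).+1 -> schubert;
  sorder_bij : bijective sorder;
  sorder_mono : forall i j, preceq (sorder i) (sorder j) -> (i <= j)%N }.

Definition rows_at (K : Type) (l : schubert) (A : 'M[K]_(n, d)) : 'M[K]_d :=
  rowsub (symb l) A.

Lemma symb_lt (l : schubert) (i j : 'I_d) :
  (i < j)%N -> (symb l i < symb l j)%N.
Proof.
case: l => l sl ij; rewrite /symb /=.
have x0 := tnth l i; rewrite !(tnth_nth x0) -!(nth_map _ 0%N val) ?size_tuple //.
by apply: (sorted_ltn_nth ltn_trans) => //; rewrite inE size_map size_tuple.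
Qed.

Lemma symb_inj (l : schubert) : injective (symb l).
Proof.
move=> i j e; apply/val_inj; case: (ltngtP i j) => // /(symb_lt l);
  by rewrite e ltnn.
Qed.

Lemma schubert_of_inj (f : 'I_d -> 'I_n) : injective f ->
  exists mu : schubert, [set symb mu j | j : 'I_d]%SET = [set f j | j : 'I_d]%SET.
Proof.
move=> fi; set A := [set f j | j : 'I_d]%SET.
have sA : size (enum A) == d by rewrite -cardE card_imset // card_ord.
have inc : sorted ltn (map val (Tuple sA)).
  rewrite /= -[enum _](eq_filter (mem_enum _)).
  rewrite -(eq_filter (mem_map val_inj _)) -filter_map.
  by rewrite (sorted_filter ltn_trans) // unlock val_ord_enum iota_ltn_sorted.
exists (exist _ (Tuple sA) inc); apply/setP => x; rewrite -[x \in A]mem_enum.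
apply/imsetP/idP => [[j _ ->]|xA]; first exact: (mem_tnth j (Tuple sA)).
by have /tnthP[j ->] : x \in Tuple sA by []; exists j.
Qed.

Variables (W : 'I_n -> nat) (a : nat) (lam : schubert_order).

Definition weight (i : 'I_('C(n, d).-1).+1) : nat :=
  (a + \sum_(j < d) W (symb (lam i) j))%N.

Definition weight_gcd (k : 'I_('C(n, d).-1).+1) : nat :=
  \big[gcdn/0%N]_(i < ('C(n, d).-1).+1 | (i <= k)%N) weight i.

Lemma weight_gcd_dvd (k i : 'I_('C(n, d).-1).+1) :
  (i <= k)%N -> (weight_gcd k %| weight i)%N.
Proof. by move=> ik; apply: (@biggcdn_inf _ i). Qed.

Lemma weight_gt0 (i : 'I_('C(n, d).-1).+1) : (0 < a)%N -> (0 < weight i)%N.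
Proof. by move=> a0; rewrite /weight ltn_addr. Qed.

End SchubertSymbols.

Section Cells.
Variables (K : fieldType) (n d : nat).
Implicit Types (A B : 'M[K]_(n, d)) (l mu : schubert n d).

Definition in_cell l (V : {vspace 'cV[K]_n}) : Prop := forall j : 'I_d,
  \dim (V :&: flag K n (symb l j).+1) = j.+1 /\
  \dim (V :&: flag K n (symb l j)) = j.

Lemma det_mulmx_inj p (M : 'M[K]_p) :
  (\det M != 0) <-> (forall u : 'cV_p, M *m u = 0 -> u = 0).
Proof.
rewrite -unitfE -unitmxE -row_full_unit mulmx_inj_rank.
by split => [/eqP|rk]; last exact/eqP.
Qed.

Lemma rows_at_inj (f : 'I_d -> 'I_n) mu A :
  [set symb mu j | j : 'I_d]%SET = [set f j | j : 'I_d]%SET ->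
  (forall u : 'cV_d, rowsub f A *m u = 0 -> u = 0) -> \det (rows_at mu A) != 0.
Proof.
move=> fmu inj; apply/det_mulmx_inj => u Au; apply: inj.
have rE (g : 'I_d -> 'I_n) j : (rowsub g A *m u) j 0 = (A *m u) (g j) 0.
  by rewrite !mxE; apply: eq_bigr => i _; rewrite mxE.
apply/colP => j; rewrite rE [RHS]mxE.
have /imsetP[i _ ->] : f j \in [set symb mu j | j : 'I_d]%SET.
  by rewrite fmu imset_f.
by rewrite -rE; move/colP: Au => ->; rewrite mxE.
Qed.

Lemma full_rank_minor A : \rank A = d -> exists mu, \det (rows_at mu A) != 0.
Proof.
move=> rA; have fA : row_full A by rewrite /row_full rA.
have [mu mE] := schubert_of_inj (@fullrankfun_inj _ _ _ _ fA).
exists mu; apply: (rows_at_inj mE); apply/det_mulmx_inj.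
by rewrite -unitfE -unitmxE fullrowsub_unit.
Qed.

Lemma det_block0 (M : 'M[K]_d) (j : 'I_d) :
  (forall i c : 'I_d, (j <= i)%N -> (c <= j)%N -> M i c = 0) -> \det M = 0.
Proof.
move=> M0; apply: big1 => s _.
suff [i /andP[ji sj]] : exists i : 'I_d, (j <= i)%N && (s i <= j)%N.
  by rewrite (bigD1 i)//= M0 // mul0r mulr0.
apply/existsP; apply: contraT => /existsPn no.
pose S := [set i : 'I_d | (j <= i)%N]%SET.
have sub : [set s i | i in S]%SET \subset (S :\ j)%SET.
  apply/fintype.subsetP => _ /imsetP[i + ->]; rewrite !inE => ji.
  move: (no i); rewrite ji /= -ltnNge => js.
  by rewrite (ltnW js) andbT -(inj_eq val_inj) gtn_eqF.
have := subset_leq_card sub; rewrite card_imset; last exact: perm_inj.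
by rewrite (cardsD1 j S) inE leqnn add1n ltnn.
Qed.

Lemma cell_echelon l V : \dim V = d -> in_cell l V ->
  exists B, [/\ colspan B = V, rows_at l B = 1%:M &
    forall mu, \det (rows_at mu B) != 0 -> preceq mu l].
Proof.
move=> dV cV.
have /choice[v vP] : forall j, exists v : 'cV[K]_n,
    [/\ v \in V, v \in flag K n (symb l j).+1 & v (symb l j) 0 != 0].
  move=> j; have [d1 d2] := cV j; apply: contrapT => no.
  suff /dimvS : (V :&: flag K n (symb l j).+1 <= V :&: flag K n (symb l j))%VS.
    by rewrite d1 d2 ltnn.
  apply/subvP => v /memv_capP[vV vF]; apply/memv_capP; split => //.
  apply/flagP => i; rewrite leq_eqVlt => /predU1P[/val_inj <-|]; last first.
    exact: (flagP _ _ vF).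
  by apply/eqP; apply: contrapT => /negP v0; apply: no; exists v.
pose M := \matrix_(i < n, j < d) v j i 0.
have M0 (p : 'I_n) c : (symb l c < p)%N -> M p c = 0.
  by move=> cp; rewrite mxE; have [_ /flagP vc _] := vP c; exact: vc.
have uM : rows_at l M \in unitmx.
  rewrite -unitmx_tr unitmxE unitfE det_trig; last first.
    by apply/is_trig_mxP => i j ij; rewrite !mxE -(M0 _ _ (symb_lt l ij)) mxE.
  by apply/prodf_neq0 => i _; rewrite !mxE; have [] := vP i.
have rowsM mu (A : 'M[K]_(n, d)) (U : 'M[K]_d) :
  rows_at mu (A *m U) = rows_at mu A *m U by rewrite /rows_at mul_rowsub_mx.
have rM : \rank M = d.
  have dM : \det (rows_at l M) != 0 by rewrite -unitfE -unitmxE.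
  apply/mulmx_inj_rank => u Mu0; apply: ((det_mulmx_inj _).1 dM).
  apply/colP => i; move/colP: Mu0 => /(_ (symb l i)); rewrite !mxE => Mu0.
  by rewrite -[RHS]Mu0; apply: eq_bigr => c _; rewrite mxE.
have cM : colspan M = V.
  apply/eqP; rewrite eqEdim (dim_colspan rM) dV leqnn andbT.
  apply/subvP => w /colspanP[u ->].
  have -> : M *m u = \sum_j u j 0 *: v j.
    apply/colP => i; rewrite !mxE summxE; apply: eq_bigr => j _.
    by rewrite !mxE mulrC.
  by apply: rpred_sum => j _; apply: rpredZ; have [] := vP j.
exists (M *m invmx (rows_at l M)); split.
- by rewrite colspan_mulr // unitmx_inv.
- by rewrite rowsM mulmxV.
move=> mu; rewrite rowsM det_mulmx mulf_eq0 negb_or => /andP[dmu _].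
apply/forallP => j; rewrite leqNgt; apply: contra dmu => lj.
apply/eqP/(@det_block0 _ j) => i c ji cj; rewrite mxE M0 //.
apply: leq_trans (leq_trans lj _).
  by move: cj; rewrite ltnS leq_eqVlt => /predU1P[/val_inj ->//|/(symb_lt l)/ltnW].
by move: ji; rewrite leq_eqVlt => /predU1P[/val_inj ->//|/(symb_lt mu)/ltnW].
Qed.

End Cells.
Section WeightedProjective.
Variables (R : realType) (N : nat).

Definition punctured := set_type [set z : 'rV[R[i]]_N | z != 0].

HB.instance Definition _ := Topological.on punctured.

Variable b : 'I_N -> nat.

Definition wrel : rel punctured := fun z z' =>
  `[< exists2 t : R[i], t != 0 &
        forall i, \val z' 0 i = t ^+ b i * \val z 0 i >].

Lemma wrel_refl : reflexive wrel.
Proof.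
move=> z; apply/asboolP; exists 1; first exact: oner_neq0.
by move=> i; rewrite expr1n mul1r.
Qed.

Lemma wrel_symW z z' : wrel z z' -> wrel z' z.
Proof.
move=> /asboolP[t t0 e]; apply/asboolP; exists t^-1; first by rewrite invr_eq0.
by move=> i; rewrite e exprVn mulKf // expf_neq0.
Qed.

Lemma wrel_sym : symmetric wrel.
Proof. by move=> z z'; apply/idP/idP; apply: wrel_symW. Qed.

Lemma wrel_trans : transitive wrel.
Proof.
move=> y x z /asboolP[s s0 es] /asboolP[t t0 et]; apply/asboolP.
exists (t * s); first by rewrite mulf_neq0.
by move=> i; rewrite et es exprMn mulrA.
Qed.

Canonical wrel_equiv := EquivRel wrel wrel_refl wrel_sym wrel_trans.

Definition WP := quotient_topology {eq_quot wrel_equiv}.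

HB.instance Definition _ := Topological.on WP.

Definition wproj (z : punctured) : WP := \pi_({eq_quot wrel_equiv}) z.

End WeightedProjective.

Section Pluecker.
Variables (R : realType) (n d : nat).
Local Notation C := R[i].

Definition full_rank : set 'M[C]_(n, d) := [set A | \rank A = d].

Variable lam : schubert_order n d.

Definition pluecker (A : 'M[C]_(n, d)) : 'rV[C]_('C(n, d).-1).+1 :=
  \row_i \det (rows_at (lam i) A).

Variable k : 'I_('C(n, d).-1).+1.

Definition Xtilde : set 'M[C]_(n, d) :=
  [set A | full_rank A /\ forall j : 'I_('C(n, d).-1).+1,
    (k < j)%N -> \det (rows_at (lam j) A) = 0].

(* The inclusion of {0, .., k} into {0, .., m}. *)
Definition firsts : 'I_k.+1 -> 'I_('C(n, d).-1).+1 := widen_ord (ltn_ord k).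

(* P followed by the projection to the first k + 1 coordinates. *)
Definition pluecker_trunc (A : 'M[C]_(n, d)) : 'rV[C]_k.+1 :=
  \row_i pluecker A 0 (firsts i).

Lemma pluecker_trunc_neq0 A : Xtilde A -> pluecker_trunc A != 0.
Proof.
move=> [rA A0]; have [mu dmu] := full_rank_minor rA.
have [g _ gK] := sorder_bij lam.
have gk : (g mu < k.+1)%N.
  by rewrite ltnS leqNgt; apply: contra dmu => /A0; rewrite gK => ->.
apply: contra dmu => /eqP/rowP/(_ (Ordinal gk)); rewrite !mxE.
by rewrite (_ : firsts _ = g mu) ?gK => [->//|]; apply/val_inj.
Qed.

(* The subspace pi'_b (P (Xtilde)) of the weighted projective space; by
   pluecker_trunc_neq0, all of P (Xtilde) lies in the punctured space. *)
Definition PX (b : 'I_k.+1 -> nat) : set (WP R b) :=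
  @wproj R _ b @` [set z | (pluecker_trunc @` Xtilde) (\val z)].

End Pluecker.

Arguments PX R {n d} lam k b _.

Section RootActions.
Variables (R : realType) (c : nat) (T : Type).
Local Notation C := R[i].

Definition roots1 (e : nat) : set C := [set t | t ^+ e = 1].

(* Actions of the group of c-th roots of unity on T; the values of root_act at
   other scalars are irrelevant. *)
Record root_action := RootAction {
  root_act :> C -> T -> T;
  root_act_gt0 : (0 < c)%N;
  root_act1 : forall x, root_act 1 x = x;
  root_actM : forall s t x, roots1 c s -> roots1 c t ->
    root_act (s * t) x = root_act s (root_act t x) }.

End RootActions.

Section OrbitSpaces.
Variables (R : realType) (c : nat) (T : topologicalType).
Variable act : root_action R c T.

Definition orbit_rel : rel T := fun x y =>
  `[< exists2 t : R[i], roots1 c t & act t x = y >].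

Lemma orbit_refl : reflexive orbit_rel.
Proof.
move=> x; apply/asboolP; exists 1; last exact: root_act1.
by rewrite /roots1 /= expr1n.
Qed.

Lemma orbit_symW x y : orbit_rel x y -> orbit_rel y x.
Proof.
move=> /asboolP[t tc <-]; apply/asboolP.
have c0 := root_act_gt0 act; exists (t ^+ c.-1).
  by rewrite /roots1 /= exprAC tc expr1n.
rewrite -root_actM //; last by rewrite /roots1 /= exprAC tc expr1n.
by rewrite -exprSr prednK // tc root_act1.
Qed.

Lemma orbit_sym : symmetric orbit_rel.
Proof. by move=> x y; apply/idP/idP; apply: orbit_symW. Qed.

Lemma orbit_trans : transitive orbit_rel.
Proof.
move=> y x z /asboolP[s sc <-] /asboolP[t tc <-]; apply/asboolP.
exists (t * s); last by rewrite root_actM.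
by rewrite /roots1 /= exprMn sc tc mulr1.
Qed.

Canonical orbit_equiv := EquivRel orbit_rel orbit_refl orbit_sym orbit_trans.

Definition orbit_space := quotient_topology {eq_quot orbit_equiv}.

HB.instance Definition _ := Topological.on orbit_space.

End OrbitSpaces.

Section Grassmannian.
Variables (R : realType) (n d : nat).
Local Notation C := R[i].

Definition frames := set_type (@full_rank R n d).

HB.instance Definition _ := Topological.on frames.

Record grpoint := GrPoint {
  gr_space :> {vspace 'cV[C]_n};
  _ : \dim gr_space == d }.

HB.instance Definition _ := [isSub for gr_space].

Lemma gr_dim (X : grpoint) : \dim X = d.
Proof. by case: X => V /= /eqP. Qed.

Lemma frames_rank (A : frames) : \rank (\val A) = d.
Proof. exact: (set_valP A). Qed.

Definition gr_pi (A : frames) : grpoint :=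
  GrPoint (introT eqP (dim_colspan (frames_rank A))).

Lemma gr_pi_surj (X : grpoint) : exists A, gr_pi A = X.
Proof.
have [A rA cA] := colspan_surj (gr_dim X).
have fA : full_rank A by [].
by exists (exist _ A (mem_set fA)); apply/val_inj.
Qed.

Definition gr_repr (X : grpoint) : frames := projT1 (cid (gr_pi_surj X)).

Lemma gr_reprK : cancel gr_repr gr_pi.
Proof. by move=> X; rewrite /gr_repr; case: cid. Qed.

HB.instance Definition _ := isQuotient.Build frames grpoint gr_reprK.

Lemma gr_piE (A : frames) : \pi_grpoint A = gr_pi A.
Proof. by rewrite unlock. Qed.

Definition Gr := quotient_topology (grpoint : quotType frames).

HB.instance Definition _ := Topological.on Gr.

Definition cell (l : schubert n d) : set Gr :=
  [set X : Gr | in_cell l (gr_space X)].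

End Grassmannian.

Section TorusActions.
Variables (R : realType) (n d : nat) (W : 'I_n -> nat).
Local Notation C := R[i].

Definition torus (t : C) : 'M[C]_n := diag_mx (\row_i t ^+ W i).

(* The image of V under the torus element; on a column space colspan A it is
   colspan (torus t *m A), see colspan_mul and gr_act_pi. *)
Definition torus_space (t : C) (V : {vspace 'cV[C]_n}) : {vspace 'cV[C]_n} :=
  (linfun (mulmx (torus t) : 'cV[C]_n -> 'cV[C]_n) @: V)%VS.

(* insubd defaults to X when t = 0, and similarly in cell_act. *)
Definition gr_act (t : C) (X : Gr R n d) : Gr R n d :=
  insubd (X : grpoint R n d) (torus_space t (gr_space X)).

Definition cell_act (l : schubert n d) (t : C) (X : set_type (@cell R n d l)) :
    set_type (@cell R n d l) :=
  insubd X (gr_act t (\val X)).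

Lemma torus_unit t : t != 0 -> torus t \in unitmx.
Proof.
move=> t0; rewrite unitmxE unitfE det_diag; apply/prodf_neq0 => i _.
by rewrite mxE expf_neq0.
Qed.

Lemma torus_space_capker t V : t != 0 ->
  (V :&: lker (linfun (mulmx (torus t) : 'cV[C]_n -> 'cV[C]_n)) = 0)%VS.
Proof. by move=> t0; rewrite (eqP (linfun_ker0 (torus_unit t0))) capv0. Qed.

Lemma gr_actE t X : t != 0 -> gr_space (gr_act t X) = torus_space t (gr_space X).
Proof.
move=> t0; apply: insubdK; apply/eqP.
by rewrite limg_dim_eq ?torus_space_capker // gr_dim.
Qed.

Lemma gr_act_pi t (A : frames R n d) : t != 0 ->
  gr_space (gr_act t (gr_pi A)) = colspan (torus t *m \val A).
Proof. by move=> t0; rewrite gr_actE // /torus_space colspan_mul. Qed.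

Lemma cell_actE l t (X : set_type (@cell R n d l)) : t != 0 ->
  \val (cell_act t X) = gr_act t (\val X).
Proof.
move=> t0; apply: insubdK; apply/mem_set => j.
have fl k : (torus_space t (gr_space (\val X)) :&: flag C n k =
    torus_space t (gr_space (\val X) :&: flag C n k))%VS.
  rewrite /torus_space lker0_img_cap ?linfun_ker0 ?torus_unit //.
  by rewrite flag_diag // torus_unit.
by rewrite gr_actE // !fl !limg_dim_eq ?torus_space_capker //; apply: (set_valP X).
Qed.

Lemma torus1 V : torus_space 1 V = V.
Proof.
rewrite /torus_space (_ : torus 1 = 1%:M).
  rewrite (_ : linfun _ = \1%VF) ?lim1g //.
  by apply/lfunP => v; rewrite !lfunE /= mul1mx.
by apply/matrixP => i j; rewrite !mxE expr1n.
Qed.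

Lemma torusM s t V : torus_space (s * t) V = torus_space s (torus_space t V).
Proof.
rewrite /torus_space -limg_comp; congr lfun_img.
apply/lfunP => v; rewrite comp_lfunE !lfunE /= mulmxA; congr (_ *m _).
by rewrite mulmx_diag; congr diag_mx; apply/rowP => i; rewrite !mxE exprMn.
Qed.

Lemma gr_space_inj : injective (@gr_space R n d : Gr R n d -> _).
Proof. exact: (@val_inj _ _ (grpoint R n d)). Qed.

Lemma cell_act1 l (X : set_type (@cell R n d l)) : cell_act 1 X = X.
Proof.
apply/val_inj/gr_space_inj.
by rewrite cell_actE ?oner_neq0 // gr_actE ?oner_neq0 // torus1.
Qed.

Lemma cell_actM l s t (X : set_type (@cell R n d l)) : s != 0 -> t != 0 ->
  cell_act (s * t) X = cell_act s (cell_act t X).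
Proof.
move=> s0 t0; have st0 : s * t != 0 by rewrite mulf_neq0.
by apply/val_inj/gr_space_inj; rewrite !(cell_actE, gr_actE) // torusM.
Qed.

Lemma roots1_neq0 e (t : C) : (0 < e)%N -> roots1 e t -> t != 0.
Proof.
by move=> e0 te; apply/eqP => t0; move: te; rewrite /roots1 /= t0 expr0n gtn_eqF //
  => /esym/eqP; rewrite oner_eq0.
Qed.

Variables (a : nat) (lam : schubert_order n d) (a0 : (0 < a)%N).
Variable (i : 'I_('C(n, d).-1).+1).

Let c := weight W a lam i.

Lemma c_gt0 : (0 < c)%N. Proof. exact: weight_gt0. Qed.

Lemma cell_action_subproof s t (X : set_type (@cell R n d (lam i))) :
  roots1 c s -> roots1 c t -> cell_act (s * t) X = cell_act s (cell_act t X).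
Proof.
by move=> /(roots1_neq0 c_gt0) ? /(roots1_neq0 c_gt0) ?; apply: cell_actM.
Qed.

(* The action of G(c_i) on E(l^i). *)
Definition cell_action : root_action R c (set_type (@cell R n d (lam i))) :=
  RootAction c_gt0 (@cell_act1 (lam i)) cell_action_subproof.

Variables (r : nat)
  (rdvd : forall j : 'I_('C(n, d).-1).+1, (j <= i)%N -> (r %| weight W a lam j)%N).

Lemma r_gt0 : (0 < r)%N. Proof. exact: dvdn_gt0 c_gt0 (rdvd (leqnn i)). Qed.

Lemma cell_act_triv t (X : set_type (@cell R n d (lam i))) :
  roots1 r t -> cell_act t X = X.
Proof.
move=> tr; have t0 := roots1_neq0 r_gt0 tr.
apply/val_inj/gr_space_inj; rewrite cell_actE // gr_actE //.
have [B [<- Bl Bmu]] := cell_echelon (gr_dim (\val X)) (set_valP X).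
have Bli p j : B (symb (lam i) p) j = (p == j)%:R.
  by move/matrixP: Bl => /(_ p j); rewrite !mxE.
pose e : 'rV[C]_d := \row_j t ^+ W (symb (lam i) j).
have -> : torus_space t (colspan B) = colspan (B *m diag_mx e).
  rewrite /torus_space colspan_mul; congr colspan.
  apply/matrixP => p j; rewrite mul_diag_mx mul_mx_diag !mxE mulrC.
  have [->|Bpj] := eqVneq (B p j) 0; first by rewrite !mul0r.
  congr (_ * _).
  have [/existsP[q /eqP pq]|/existsPn pl] :=
    boolP [exists q, p == symb (lam i) q].
    by move: Bpj; rewrite pq Bli pnatr_eq0 eqb0 negbK => /eqP ->.
  pose f q := if q == j then p else symb (lam i) q.
  have fi : injective f.
    move=> q q'; rewrite /f; case: eqP => [->|_]; case: eqP => [->|_] //.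
    - by move=> pq; move: (pl q'); rewrite pq eqxx.
    - by move=> pq; move: (pl q); rewrite -pq eqxx.
    - exact: symb_inj.
  have [mu mE] := schubert_of_inj fi.
  have muE : (\sum_(q < d) W (symb mu q) + W (symb (lam i) j) =
              \sum_(q < d) W (symb (lam i) q) + W p)%N.
    have -> : (\sum_(q < d) W (symb mu q) = \sum_(q < d) W (f q))%N.
      rewrite -(@big_imset _ _ _ _ _ (symb mu) predT W) /=; last first.
        by move=> ? ? _ _; apply: symb_inj.
      rewrite -(@big_imset _ _ _ _ _ f predT W) /=; last by move=> ? ? _ _; apply: fi.
      by apply: eq_bigl => x; rewrite mE.
    rewrite (bigD1 j)//= [in RHS](bigD1 j)//= {1}/f eqxx.
    rewrite (eq_bigr (fun q => W (symb (lam i) q))); last first.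
      by move=> q /negPf qj; rewrite /f qj.
    by rewrite addnAC [RHS]addnAC addnC [RHS]addnC [X in (_ + X)%N]addnC.
  have [g _ gK] := sorder_bij lam.
  have gi : (g mu <= i)%N.
    apply: (sorder_mono (s := lam)); rewrite gK; apply: Bmu.
    apply: (rows_at_inj mE) => u /colP fu.
    have fuE q : (rowsub f B *m u) q 0 = (B *m u) (f q) 0.
      by rewrite !mxE; apply: eq_bigr => x _; rewrite mxE.
    have lu q : (B *m u) (symb (lam i) q) 0 = u q 0.
      rewrite mxE (bigD1 q)//= Bli eqxx mul1r big1 ?addr0 // => x xq.
      by rewrite Bli eq_sym (negPf xq) mul0r.
    have uq q : q != j -> u q 0 = 0.
      by move=> qj; have := fu q; rewrite fuE /f (negPf qj) lu => ->; rewrite mxE.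
    apply/colP => q; have [->|/uq->] := eqVneq q j; rewrite mxE //.
    have := fu j; rewrite fuE /f eqxx !mxE (bigD1 j)//= big1 => [|x /uq ->];
      last by rewrite mulr0.
    by rewrite addr0 => /eqP; rewrite mulf_eq0 (negPf Bpj) => /eqP.
  have tw (x : 'I_('C(n, d).-1).+1) : (x <= i)%N -> t ^+ weight W a lam x = 1.
    by move=> /rdvd/dvdnP[y ->]; rewrite mulnC exprM tr expr1n.
  have := congr1 (fun x => t ^+ (a + x)) muE; rewrite /= !addnA.
  have := tw _ gi; have := tw _ (leqnn i); rewrite /weight gK => w1 w2.
  by rewrite exprD w2 exprD w1 !mul1r => ->.
rewrite colspan_mulr // unitmxE unitfE det_diag; apply/prodf_neq0 => j _.
by rewrite mxE expf_neq0.
Qed.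

Lemma roots1_root (s : C) : roots1 (c %/ r) s ->
  roots1 c (r.-root s) /\ (r.-root s) ^+ r = s.
Proof.
move=> sc; have rs : (r.-root s) ^+ r = s by rewrite rootCK // r_gt0.
have cE : c = (r * (c %/ r))%N by rewrite mulnC divnK // rdvd.
by split=> //; rewrite /roots1 /= cE exprM rs.
Qed.

(* The action of G(c_i / r) on E(l^i): an element t ^+ r acts as t.  Which r-th
   root of s is used is irrelevant, see cell_quot_actE. *)
Definition cell_quot_act (s : C) (X : set_type (@cell R n d (lam i))) :=
  cell_act (r.-root s) X.

Lemma cell_act_pow s t (X : set_type (@cell R n d (lam i))) :
  s != 0 -> t != 0 -> s ^+ r = t ^+ r -> cell_act s X = cell_act t X.
Proof.
move=> s0 t0 e; rewrite -(divfK t0 s) cell_actM ?mulf_neq0 ?invr_eq0 //.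
by apply: cell_act_triv; rewrite /roots1 /= exprMn exprVn e mulfV // expf_neq0.
Qed.

Lemma cell_quot_actE t X : roots1 c t ->
  cell_quot_act (t ^+ r) X = cell_act t X.
Proof.
move=> tc; have t0 := roots1_neq0 c_gt0 tc.
apply: cell_act_pow => //; last by rewrite rootCK // r_gt0.
by rewrite rootC_eq0 ?r_gt0 // expf_neq0.
Qed.

Lemma cell_quot_action_gt0 : (0 < c %/ r)%N.
Proof. by rewrite divn_gt0 ?r_gt0 // dvdn_leq ?c_gt0 // rdvd. Qed.

Lemma cell_quot_act1 X : cell_quot_act 1 X = X.
Proof. by rewrite -[1](expr1n _ r) cell_quot_actE ?cell_act1 // /roots1 /= expr1n. Qed.

Lemma cell_quot_actM s t X : roots1 (c %/ r) s -> roots1 (c %/ r) t ->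
  cell_quot_act (s * t) X = cell_quot_act s (cell_quot_act t X).
Proof.
move=> /roots1_root[sc es] /roots1_root[tc et].
rewrite -{1}es -{1}et -exprMn cell_quot_actE; first exact: cell_action_subproof.
by rewrite /roots1 /= exprMn sc tc mulr1.
Qed.

Definition cell_quot_action :
    root_action R (c %/ r) (set_type (@cell R n d (lam i))) :=
  RootAction cell_quot_action_gt0 cell_quot_act1 cell_quot_actM.

End TorusActions.

Arguments cell_quot_action R {n d} W {a} lam a0 i r rdvd.

(* Main.v *)
Require Import Defs.
From mathcomp Require Import all_boot all_order all_algebra.
From mathcomp Require Import complex.
From mathcomp Require Import all_classical reals topology.

(* On each side the two spaces are quotients of the same space by the same
   equivalence relation: since the complex numbers have r-th roots, the pairs
   (z, t . z) for the weights c are the pairs (z, (t ^ r) . z) for the weights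
   c / r, and G(c) acts through the surjection t |-> t ^ r onto G(c / r). *)

Set Implicit Arguments.
Unset Strict Implicit.
Unset Printing Implicit Defensive.

Import GRing.Theory Num.Theory.
Local Open Scope classical_set_scope.
Local Open Scope ring_scope.
Local Open Scope quotient_scope.

(* The two projections are built from different quotType structures and only
   become convertible once unlocked. *)
Lemma pi_quotient_topology (T : topologicalType) (Q : quotType T) (x : T) :
  \pi_(quotient_topology Q) x = \pi_Q x :> Q.
Proof. by rewrite !unlock. Qed.

Section Quotients.
Variables (T : topologicalType) (Q1 Q2 : quotType T).
Hypothesis same_fibers : forall x y : T,
  \pi_Q1 x = \pi_Q1 y <-> \pi_Q2 x = \pi_Q2 y.

(** The map induced by the identity of [T]. The representative is an arbitrary choice; equality of
    fibers makes the class in [Q2] independent of it. *)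
Definition quot_map (x : quotient_topology Q1) : quotient_topology Q2 :=
  \pi_(quotient_topology Q2) (repr x).

Lemma quot_map_pi (x : T) :
  quot_map (\pi_Q1 x : quotient_topology Q1) = \pi_Q2 x.
Proof.
rewrite /quot_map pi_quotient_topology; apply: (same_fibers _ _).1.
by rewrite -[LHS]pi_quotient_topology reprK.
Qed.

(** By the universal property of the quotient topology: composed with the projection to [Q1], the
    map becomes the projection to [Q2]. *)
Lemma quot_map_continuous : continuous quot_map.
Proof.
apply/quotient_continuous.
rewrite (_ : _ \o _ = \pi_(quotient_topology Q2)); first exact: pi_continuous.
apply/funext => x; rewrite [LHS]/=.
by rewrite pi_quotient_topology quot_map_pi pi_quotient_topology.
Qed.

End Quotients.

Lemma quot_mapK (T : topologicalType) (Q1 Q2 : quotType T) :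
  (forall x y : T, \pi_Q1 x = \pi_Q1 y <-> \pi_Q2 x = \pi_Q2 y) ->
  cancel (@quot_map T Q1 Q2) (@quot_map T Q2 Q1).
Proof.
move=> fib x; rewrite {2}/quot_map pi_quotient_topology quot_map_pi.
  by rewrite -[LHS]pi_quotient_topology reprK.
by move=> y z; split => /fib.
Qed.

Lemma homeomorphic_quotient (T : topologicalType) (Q1 Q2 : quotType T) :
  (forall x y : T, \pi_Q1 x = \pi_Q1 y <-> \pi_Q2 x = \pi_Q2 y) ->
  homeomorphic (quotient_topology Q1) (quotient_topology Q2).
Proof.
move=> fib12; have fib21 x y : \pi_Q2 x = \pi_Q2 y <-> \pi_Q1 x = \pi_Q1 y.
  by split => /fib12.
exists (@quot_map T Q1 Q2), (@quot_map T Q2 Q1).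
by split; [exact: quot_map_continuous..|exact: quot_mapK|exact: quot_mapK].
Qed.

(** The subspace topology is initial for the inclusion, so continuity of the restrictions is tested
    after composing with it. *)
Lemma homeomorphic_set_type (T U : topologicalType) (f : T -> U) (g : U -> T)
    (A : set T) (B : set U) :
  continuous f -> continuous g -> cancel f g -> cancel g f ->
  (forall x, A x -> B (f x)) -> (forall y, B y -> A (g y)) ->
  homeomorphic (set_type A) (set_type B).
Proof.
move=> cf cg fK gK fAB gBA.
pose F (x : set_type A) : set_type B :=
  exist _ (f (\val x)) (mem_set (fAB _ (set_valP x))).
pose G (y : set_type B) : set_type A :=
  exist _ (g (\val y)) (mem_set (gBA _ (set_valP y))).
exists F, G; split.
- apply: continuous_comp_initial => x.
  apply: (@continuous_comp _ _ _ set_val f); first exact: initial_continuous.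
  exact: cf.
- apply: continuous_comp_initial => y.
  apply: (@continuous_comp _ _ _ set_val g); first exact: initial_continuous.
  exact: cg.
- by move=> x; apply/val_inj; apply: fK.
- by move=> y; apply/val_inj; apply: gK.
Qed.

(** The images carry the subspace topology of the full quotients, so the homeomorphism of the
    quotients is restricted; it sends the class of [x] to the class of [x], hence one image onto the
    other. *)
Lemma homeomorphic_quotient_image (T : topologicalType) (Q1 Q2 : quotType T)
    (A : set T) :
  (forall x y : T, \pi_Q1 x = \pi_Q1 y <-> \pi_Q2 x = \pi_Q2 y) ->
  homeomorphic (set_type ((fun x => \pi_Q1 x : quotient_topology Q1) @` A))
               (set_type ((fun x => \pi_Q2 x : quotient_topology Q2) @` A)).
Proof.
move=> fib12; have fib21 x y : \pi_Q2 x = \pi_Q2 y <-> \pi_Q1 x = \pi_Q1 y.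
  by split => /fib12.
apply: (@homeomorphic_set_type _ _ (@quot_map T Q1 Q2) (@quot_map T Q2 Q1)).
- exact: quot_map_continuous.
- exact: quot_map_continuous.
- exact: quot_mapK.
- exact: quot_mapK.
- by move=> _ [x Ax <-]; exists x; rewrite ?quot_map_pi.
- by move=> _ [x Ax <-]; exists x; rewrite ?quot_map_pi.
Qed.

Lemma wrel_divn (R : realType) (N : nat) (b : 'I_N -> nat) (r : nat) :
  (0 < r)%N -> (forall i, (r %| b i)%N) ->
  @wrel R N b =2 @wrel R N (fun i => b i %/ r)%N.
Proof.
move=> r0 rb z z'; apply/asboolP/asboolP => -[t t0 e].
  exists (t ^+ r); first by rewrite expf_neq0.
  by move=> i; rewrite -exprM mulnC divnK.
(* For [s] an [r]-th root of [t], [s ^+ b i] is [(s ^+ r) ^+ (b i %/ r)]. *)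
exists (r.-root t); first by rewrite rootC_eq0.
by move=> i; rewrite e -{1}(rootCK r0 t) -exprM mulnC divnK.
Qed.

Lemma orbit_rel_quot (R : realType) (n d : nat) (W : 'I_n -> nat) (a : nat)
    (lam : schubert_order n d) (a0 : (0 < a)%N) (i : 'I_('C(n, d).-1).+1)
    (r : nat) (rdvd : forall j : 'I_('C(n, d).-1).+1,
      (j <= i)%N -> (r %| weight W a lam j)%N) :
  orbit_rel (cell_action R W lam a0 i) =2
  orbit_rel (cell_quot_action R W lam a0 i r rdvd).
Proof.
move=> x y; apply/asboolP/asboolP => -[t tc <-].
  (* The root chosen for [t ^+ r] may differ from [t], by an element of G(r); this acts trivially on
     the cell. *)
  exists (t ^+ r); last exact: (cell_quot_actE a0 rdvd).
  by rewrite /roots1 /= -exprM mulnC divnK // rdvd.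
(* Here [t] acts through this very root by definition; it remains to see that the root lies in
   G(c). *)
by exists (r.-root t) => //; have [] := roots1_root a0 rdvd tc.
Qed.

Theorem lemma3p3 (R : realType) (n d : nat) (d_gt0 : (0 < d)%N)
    (d_lt_n : (d < n)%N) (W : 'I_n -> nat) (a : nat) (a_gt0 : (0 < a)%N)
    (lam : schubert_order n d) (k : 'I_('C(n, d).-1).+1) (k_gt0 : (0 < k)%N) :
  let c := weight W a lam in
  let r := weight_gcd W a lam k in
  homeomorphic
    (set_type (PX R lam k (fun i => c (firsts i))))
    (set_type (PX R lam k (fun i => c (firsts i) %/ r)%N))
  /\
  homeomorphic
    (orbit_space (cell_action R W lam a_gt0 k))
    (orbit_space (cell_quot_action R W lam a_gt0 k r
       (@weight_gcd_dvd n d W a lam k))).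
Proof.
move=> c r; split.
  have rb (i : 'I_k.+1) : (r %| c (firsts i))%N.
    by apply: weight_gcd_dvd; rewrite -ltnS; exact: (ltn_ord i).
  (* The gcd is positive because it divides the weight of index 0, which is at least [a]. *)
  have r0 : (0 < r)%N := dvdn_gt0 (weight_gt0 _ _ _ a_gt0) (rb ord0).
  apply: (@homeomorphic_quotient_image (punctured R k.+1)
    {eq_quot wrel_equiv R (fun i => c (firsts i))}
    {eq_quot wrel_equiv R (fun i => c (firsts i) %/ r)%N}).
  move=> x y; split=> /eqquotP xy; apply/eqquotP.
    by rewrite /= -(wrel_divn r0 rb).
  by rewrite /= (wrel_divn r0 rb).
apply: (@homeomorphic_quotient _
  {eq_quot orbit_equiv (cell_action R W lam a_gt0 k)}
  {eq_quot orbit_equiv (cell_quot_action R W lam a_gt0 k r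
     (@weight_gcd_dvd n d W a lam k))}).
move=> x y; split=> /eqquotP xy; apply/eqquotP.
  by rewrite /= -orbit_rel_quot.
by rewrite /= (orbit_rel_quot a_gt0 (@weight_gcd_dvd n d W a lam k)).
Qed.
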